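(* Let $\alpha,a\in\mathbb{R}$. For all integers $0\le\nu\le l$ and all $x\in\mathbb{R}$, $$Q^{(\alpha,-a)}_{\nu}(x)=w_l(x)^{-1}\sigma(x)^{\nu-l}\frac{d^{\nu}}{dx^{\nu}}[w_l(x)\sigma(x)^{l}]=\frac{\sigma(x)^\nu}{w_0(x)}\frac{d^{\nu}w_0(x)}{dx^{\nu}},$$ and, for every $\mu=0,1,\ldots,\nu$, $$Q^{(\alpha,-a)}_{\nu}(x)=w_l(x)^{-1}\sigma(x)^{\nu-l}\frac{d^{\nu-\mu}}{dx^{\nu-\mu}}\left(\sigma(x)^{l-\mu}w_l(x)\,Q^{(\alpha,-a)}_{\mu}(x)\right).$$
   Context: Throughout $x$ is a real variable, $\alpha,a$ are real parameters, $\sigma(x)=1+x^2$, and $\cot^{-1}:\mathbb{R}\to(0,\pi)$ is the smooth branch, so that $\frac{d}{dx}\cot^{-1}x=-1/\sigma(x)$. For integers $l\ge 0$ put $w_l(x)=\sigma(x)^{-(l+a+1)}e^{-\alpha\cot^{-1}x}=\sigma(x)^{-l}w_0(x)$. Define $P_l^{(a,\alpha)}(x)=\frac{1}{w_l(x)}\frac{d^l}{dx^l}[w_l(x)\sigma(x)^l]=\frac{\sigma(x)^l}{w_0(x)}\frac{d^l w_0(x)}{dx^l}$. The complementary (Romanovski) polynomials $Q_\nu^{(\alpha,-a)}$, with $Q_0^{(\alpha,-a)}\equiv 1$, are defined by the Rodrigues representation $P_l^{(a,\alpha)}(x)=\frac{1}{w_l(x)}\frac{d^{l-\nu}}{dx^{l-\nu}}[\sigma(x)^{l-\nu}w_l(x)Q_\nu^{(\alpha,-a)}(x)]$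 for all integers $0\le\nu\le l$ (the case $l=\nu$ reads $Q_\nu^{(\alpha,-a)}=P_\nu^{(a,\alpha)}$). The second upper index is minus the parameter $a$ of the weight. *)

(* Defs.v *)
From mathcomp Require Import all_boot all_order all_algebra.
From mathcomp Require Import all_classical all_reals all_analysis.
Import numFieldNormedType.Exports.

Set Implicit Arguments.
Unset Strict Implicit.
Unset Printing Implicit Defensive.

Import Order.TTheory GRing.Theory Num.Theory.

Local Open Scope classical_set_scope.
Local Open Scope ring_scope.

Definition sigma (R : realType) (x : R) : R := 1 + x ^+ 2.

(* The smooth branch of the inverse cotangent, with values in ]0, pi[:
   see [arccot_gt0], [arccot_ltpi], [arccotK] and [derive1_arccot]. *)
Definition arccot (R : realType) (x : R) : R := pi / 2 - atan x.

Lemma arccot_gt0 (R : realType) (x : R) : 0 < arccot x.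
Proof. by rewrite subr_gt0 atan_ltpi2. Qed.

Lemma arccot_ltpi (R : realType) (x : R) : arccot x < pi.
Proof. by rewrite ltrBlDr {2}[pi]splitr -addrA ltrDl -ltrBlDl sub0r atan_gtNpi2. Qed.

Lemma arccotK (R : realType) (x : R) :
  cos (arccot x) / sin (arccot x) = x.
Proof.
rewrite /arccot -opprB cosN sinN cosBpihalf sinBpihalf opprK.
exact: (atanK x).
Qed.

Lemma derive1_arccot (R : realType) (x : R) :
  derive1 (@arccot R) x = - (sigma x)^-1.
Proof.
rewrite derive1E; have -> : @arccot R = cst (pi / 2) - atan by [].
by rewrite derive_val sub0r.
Qed.

Definition weight (R : realType) (a alpha : R) (l : nat) (x : R) : R :=
  powR (sigma x) (- (l%:R + a + 1)) * expR (- (alpha * arccot x)).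

Definition romanovskiP (R : realType) (a alpha : R) (l : nat) (x : R) : R :=
  (weight a alpha l x)^-1 *
  derive1n l (fun t => weight a alpha l t * sigma t ^+ l) x.

(* As in Q_nu^(alpha, b), the second parameter [b] is minus the parameter of
   the weight; each Q nu must satisfy the Rodrigues representation for all
   l >= nu at once. *)
Definition rodrigues_family (R : realType) (alpha b : R)
    (Q : nat -> {poly R}) : Prop :=
  Q 0%N = 1 /\
  forall nu l : nat, (nu <= l)%N -> forall x : R,
    romanovskiP (- b) alpha l x =
    (weight (- b) alpha l x)^-1 *
    derive1n (l - nu)
      (fun t => sigma t ^+ (l - nu) * weight (- b) alpha l t * (Q nu).[t]) x.

(* The family singled out by [rodrigues_family]. The case l = nu of the
   representation determines the values of Q nu, so there is at most one. *)
Definition romanovskiQ (R : realType) (alpha b : R) : nat -> {poly R} :=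
  xget (fun=> 0) [set Q | rodrigues_family alpha b Q].

(* Main.v *)
Require Import Defs.
From mathcomp Require Import all_boot all_order all_algebra.
From mathcomp Require Import all_classical all_reals all_analysis.
From mathcomp Require Import ring.

Set Implicit Arguments.
Unset Strict Implicit.
Unset Printing Implicit Defensive.

Import Order.TTheory GRing.Theory Num.Theory.
Import numFieldNormedType.Exports.

Local Open Scope ring_scope.

(** Everything happens inside the sequence of derivatives of the single
    function [weight a alpha 0], written w_0 here. Because w_l sigma^l = w_0
    ([weight_sigma]) and w_n' is w_(n+1) times a linear polynomial
    ([is_derive_weight]), induction on n gives w_0^(n) = w_n q_n with q_n a
    polynomial ([derive1n_weight]). Then
    sigma^(l - n) w_l q_n = w_n q_n = w_0^(n), so taking l - n more
    derivatives of it yields w_0^(l): the sequence q is a Rodrigues family.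

    Conversely the diagonal case l = n of the Rodrigues representation forces
    w_0^(n) = w_n Q_n for every such family ([rodrigues_derive1n_weight]), in
    particular for the chosen one. Both closed formulas for Q_nu are this
    identity with the powers of sigma rearranged, and the formula starting
    from Q_mu says that w_0^(nu) is the (nu - mu)-th derivative of
    w_0^(mu) = sigma^(l - mu) w_l Q_mu. *)

Lemma sigma_gt0 (R : realType) (x : R) : 0 < sigma x.
Proof. by rewrite ltr_pwDl// sqr_ge0. Qed.

Lemma sigma_neq0 (R : realType) (x : R) : sigma x != 0.
Proof. by rewrite gt_eqF// sigma_gt0. Qed.

Lemma weight_neq0 (R : realType) (a alpha : R) (l : nat) (x : R) :
  weight a alpha l x != 0.
Proof. by rewrite gt_eqF// mulr_gt0 ?expR_gt0 ?powR_gt0 ?sigma_gt0. Qed.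

Lemma weight_sigma (R : realType) (a alpha : R) (k l : nat) (x : R) :
  (k <= l)%N -> weight a alpha l x * sigma x ^+ (l - k) = weight a alpha k x.
Proof.
move=> le_kl; rewrite /weight -powR_mulrn ?ltW ?sigma_gt0// mulrAC -powRD.
  by congr (powR _ _ * _); rewrite natrB//; ring.
by rewrite sigma_neq0 implybT.
Qed.

Lemma weight_sigma0 (R : realType) (a alpha : R) (l : nat) :
  (fun t => weight a alpha l t * sigma t ^+ l) = weight a alpha 0.
Proof. by apply/funext => t; rewrite -(@weight_sigma _ _ _ 0 l) ?subn0. Qed.

(** Logarithmic differentiation gives
    w_l' / w_l = (alpha - 2 (l + a + 1) x) / sigma, and w_l / sigma is the
    next weight. *)
Lemma is_derive_weight (R : realType) (a alpha : R) (l : nat) (x : R) :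
  is_derive x 1 (weight a alpha l)
    (weight a alpha l.+1 x * (alpha - (l%:R + a + 1) * x *+ 2)).
Proof.
have dsigma : is_derive x 1 (@sigma R) (x *+ 2).
  rewrite (_ : @sigma R = cst 1 + id ^+ 2)//; apply: is_derive_eq.
  by rewrite add0r scaler1 expr1 mulr_natl.
have dpow := is_derive1_comp
  (is_derive1_powR (- (l%:R + a + 1)) (sigma_gt0 x)) dsigma.
have darccot : is_derive x 1 (@arccot R) (- (sigma x)^-1).
  rewrite -[- _]sub0r; exact: is_deriveB.
have dexp := is_derive1_comp (is_derive_expR ((- (alpha \*: @arccot R)) x))
  (is_deriveN (is_deriveZ alpha darccot)).
apply: is_derive_eq (is_deriveM dpow dexp) _.
rewrite /weight /= /GRing.scale /=.
have -> : - (l.+1%:R + a + 1) = - (l%:R + a + 1) - 1 :> R by rewrite -natr1; ring.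
have -> : powR (sigma x) (- (l%:R + a + 1)) =
    sigma x * powR (sigma x) (- (l%:R + a + 1) - 1).
  rewrite powRB ?sigma_neq0 ?implybT// powRr1 ?ltW ?sigma_gt0//.
  by rewrite mulrCA divff ?mulr1 ?sigma_neq0.
by field; rewrite sigma_neq0.
Qed.

(** The recurrence is the product rule applied to w_n q_n, using
    w_n = sigma w_(n+1) for the term w_n q_n'. *)
Fixpoint weight_derivative_poly (R : realType) (a alpha : R) (n : nat) :
    {poly R} :=
  if n is m.+1 then
    let q := weight_derivative_poly a alpha m in
    (1 + 'X^2) * q^`() + (alpha%:P - ((m%:R + a + 1) *+ 2) *: 'X) * q
  else 1.

Lemma derive1n_weight (R : realType) (a alpha : R) (n : nat) :
  derive1n n (weight a alpha 0) =
  fun t => weight a alpha n t * (weight_derivative_poly a alpha n).[t].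
Proof.
elim: n => [|n IHn]; first by apply/funext => t; rewrite /= hornerE mulr1.
apply/funext => t; rewrite /derive1n iterS -/(derive1n n _) IHn derive1E.
set q := weight_derivative_poly a alpha n.
have dq : is_derive t 1 (weight a alpha n * horner q) _ :=
  is_deriveM (is_derive_weight a alpha n t) (is_derive_poly q t).
rewrite (@derive_val _ _ _ _ _ _ _ dq) -(@weight_sigma _ _ _ n n.+1)//.
have -> : (weight_derivative_poly a alpha n.+1).[t] =
    sigma t * q^`().[t] + (alpha - (n%:R + a + 1) * t *+ 2) * q.[t].
  by rewrite /= -/q !hornerE /sigma mulrnAl.
rewrite subSnn expr1 -![_ *: _]/(_ * _); ring.
Qed.

Lemma weight_derivative_poly_rodrigues (R : realType) (a alpha : R) :
  rodrigues_family alpha (- a) (weight_derivative_poly a alpha).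
Proof.
split=> // nu l le_nu_l x; rewrite opprK /romanovskiP weight_sigma0.
have -> : (fun t => sigma t ^+ (l - nu) * weight a alpha l t *
    (weight_derivative_poly a alpha nu).[t]) = derive1n nu (weight a alpha 0).
  rewrite derive1n_weight; apply/funext => t.
  by rewrite [sigma t ^+ _ * _]mulrC weight_sigma.
by rewrite /derive1n -iterD subnK.
Qed.

(** On the diagonal l = n the right-hand side of the representation contains
    no derivative, so it can be solved for the values of Q_n. *)
Lemma rodrigues_derive1n_weight (R : realType) (a alpha : R)
    (Q : nat -> {poly R}) (n : nat) (x : R) :
  rodrigues_family alpha (- a) Q ->
  derive1n n (weight a alpha 0) x = weight a alpha n x * (Q n).[x].
Proof.
case=> _ /(_ n n (leqnn n) x).
rewrite opprK /romanovskiP weight_sigma0 subnn /= expr0 mul1r.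
by move/(mulfI (invr_neq0 (weight_neq0 _ _ _ _))).
Qed.

Lemma derive1n_weight_romanovskiQ (R : realType) (a alpha : R) (n : nat)
    (x : R) :
  derive1n n (weight a alpha 0) x =
  weight a alpha n x * (romanovskiQ alpha (- a) n).[x].
Proof.
apply: rodrigues_derive1n_weight.
exact: (xgetPex _ (ex_intro _ _ (weight_derivative_poly_rodrigues a alpha))).
Qed.

Theorem theorem1p5 (R : realType) (alpha a : R) (nu l : nat)
    (le_nu_l : (nu <= l)%N) (x : R) :
  [/\ (romanovskiQ alpha (- a) nu).[x] =
        (weight a alpha l x)^-1 * sigma x ^ (nu%:Z - l%:Z) *
        derive1n nu (fun t => weight a alpha l t * sigma t ^+ l) x,
      (weight a alpha l x)^-1 * sigma x ^ (nu%:Z - l%:Z) *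
        derive1n nu (fun t => weight a alpha l t * sigma t ^+ l) x =
        sigma x ^+ nu / weight a alpha 0 x * derive1n nu (weight a alpha 0) x
    & forall mu : nat, (mu <= nu)%N ->
      (romanovskiQ alpha (- a) nu).[x] =
        (weight a alpha l x)^-1 * sigma x ^ (nu%:Z - l%:Z) *
        derive1n (nu - mu) (fun t => sigma t ^+ (l - mu) * weight a alpha l t *
                                   (romanovskiQ alpha (- a) mu).[t]) x].
Proof.
have prefactor : (weight a alpha l x)^-1 * sigma x ^ (nu%:Z - l%:Z) =
    (weight a alpha nu x)^-1.
  rewrite -(weight_sigma a alpha x le_nu_l) [RHS]invfM; congr (_ * _).
  by rewrite -opprB subzn// exprnN.
have QE : (romanovskiQ alpha (- a) nu).[x] =
    (weight a alpha nu x)^-1 * derive1n nu (weight a alpha 0) x.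
  by rewrite derive1n_weight_romanovskiQ mulKf ?weight_neq0.
rewrite weight_sigma0 prefactor; split=> // [|mu le_mu_nu].
  rewrite -(@weight_sigma _ a alpha 0 nu x)// subn0 [in RHS]invfM.
  by rewrite [sigma x ^+ nu * _]mulrCA divff ?mulr1 ?expf_neq0 ?sigma_neq0.
have iterated_derive : derive1n nu (weight a alpha 0) =
    derive1n (nu - mu) (derive1n mu (weight a alpha 0)).
  by rewrite /derive1n -iterD subnK.
rewrite QE iterated_derive; congr (_ * _); congr (derive1n _ _ x).
apply/funext => t.
rewrite derive1n_weight_romanovskiQ [sigma t ^+ _ * _]mulrC weight_sigma//.
exact: leq_trans le_mu_nu le_nu_l.
Qed.
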